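(* For every $x \in (0,\pi]$, $$\frac{1}{2100}x^7 < x - \frac{3\sin x}{2+\cos x}\left(1+\frac{(1-\cos x)^2}{9(3+2\cos x)}\right) \le \frac{1}{m_2}x^7,$$ where $m_2 = 1/g(\tau_0) = 899.04062\ldots$ is the constant determined by the function $$g(\tau)=\frac{\tau-\frac{3\sin \tau}{2+\cos \tau}\left(1+\frac{(1-\cos \tau)^2}{9(3+2\cos \tau)}\right)}{\tau^7}$$ and the point $\tau_0=2.87934\ldots$, the unique solution in $(0,\pi)$ of the equation $$\frac{294\sin\tau+217\cos\tau\sin\tau+14\cos^2\tau\sin\tau}{2\cos^3\tau+78\cos^2\tau+258\cos\tau+187}=\tau .$$
   Context: The numerical expressions with dots (such as $899.04062\ldots$) denote the initial decimal digits of the constants concerned. The value $M_2=g(\tau_0)=0.001112\ldots$ is the maximum of $g$ on $(0,\pi)$, and $m_2=1/M_2$. *)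

(* Defs.v *)
From Stdlib Require Import Reals.
Open Scope R_scope.

Definition cusa_error (x : R) : R :=
  x - 3 * sin x / (2 + cos x)
      * (1 + (1 - cos x) ^ 2 / (9 * (3 + 2 * cos x))).

(* Only meaningful for t <> 0.  Note that 3 + 2 cos t >= 1 everywhere. *)
Definition g (t : R) : R := cusa_error t / t ^ 7.

(* The denominator is positive on [0, PI], so the division is never by zero
   where the equation is considered. *)
Definition critical_eq (t : R) : Prop :=
  (294 * sin t + 217 * cos t * sin t + 14 * cos t ^ 2 * sin t)
  / (2 * cos t ^ 3 + 78 * cos t ^ 2 + 258 * cos t + 187) = t.

(* Main.v *)
Require Import Defs.
From Stdlib Require Import Reals Factorial Lra Lia.
From Coquelicot Require Import Coquelicot.
Open Scope R_scope.

(** Write [s = sin x], [c = cos x] and [f = cusa_error].  Everything rests on two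
    factorisations.  First, the factor [2 + c] cancels, so that
    [f = x - s (14 + c) / (3 (3 + 2c))], and then
    [f' = 2 (1 - c)^3 / (3 (3 + 2c)^2)].

    The lower bound compares derivatives: [x^7 / 2100] and [f] both vanish at 0,
    and [f' > x^6 / 300] on (0, PI).  In the half angle [u = x / 2] this is the
    square of [5 sin^3 u > u^3 (5 - 4 sin^2 u)], which a Taylor bound of the sine
    reduces to a polynomial inequality ([five_sin_cube_gt],
    [cusa_error_slope_gt]).

    For the upper bound, [g'] has the sign of [x f' - 7 f], hence that of
    [critical_gap], the difference of the two sides of the critical equation.
    Here is the second factorisation: the derivative of [critical_gap] is
    [(1 - c)^4 (304 + 330c - 4c^2)] over a square, so it changes sign once, from
    plus to minus.  As [critical_gap] is 0 at 0, it is positive up to its root in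
    (0, PI) and negative after it ([critical_gap_falls]): the root is unique
    and [g] attains its maximum there ([g_le_at_root]).

    The decimals come from alternating Taylor sums at two rational points: the
    sign of [critical_gap] encloses the root between them ([critical_gap_root_lo],
    [critical_gap_root_hi]), and the monotonicity of [f] turns its values at the
    two points into an enclosure of [1 / g] ([inv_g_enclosure]). *)

(** * Strict monotonicity from the sign of the derivative *)

Lemma is_derive_pos_lt (f f' : R -> R) (a b : R) :
  a < b ->
  (forall c, a <= c <= b -> is_derive f c (f' c)) ->
  (forall c, a < c < b -> 0 < f' c) ->
  f a < f b.
Proof.
  intros hab hd hpos.
  destruct (MVT_cor2 f f' a b hab) as [c [heq hc]].
  - intros c hc. apply is_derive_Reals, hd, hc.
  - pose proof (Rmult_lt_0_compat (f' c) (b - a) (hpos c hc) ltac:(lra)). lra.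
Qed.

Lemma is_derive_neg_lt (f f' : R -> R) (a b : R) :
  a < b ->
  (forall c, a <= c <= b -> is_derive f c (f' c)) ->
  (forall c, a < c < b -> f' c < 0) ->
  f b < f a.
Proof.
  intros hab hd hneg.
  apply Ropp_lt_cancel.
  apply (is_derive_pos_lt (fun x => - f x) (fun x => - f' x) a b hab).
  - intros c hc. apply (is_derive_opp f c (f' c)), hd, hc.
  - intros c hc. specialize (hneg c hc). lra.
Qed.

Lemma cos_sin_sqr (x : R) : sin x ^ 2 = 1 - cos x ^ 2.
Proof. pose proof (sin2_cos2 x) as h. unfold Rsqr in h. simpl. lra. Qed.

Lemma cos_interior (x : R) : 0 < x < PI -> -1 < cos x < 1.
Proof.
  intros hx. rewrite <- cos_PI, <- cos_0.
  split; apply cos_decreasing_1; lra.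
Qed.

(** * The error function and its derivative *)

(** The factor [2 + cos x] cancels because
    [9 (3 + 2c) + (1 - c)^2 = (c + 2) (c + 14)]. *)
Lemma cusa_error_reduced (x : R) :
  cusa_error x = x - sin x * (14 + cos x) / (3 * (3 + 2 * cos x)).
Proof.
  unfold cusa_error. pose proof (COS_bound x). field. lra.
Qed.

Lemma cusa_error_0 : cusa_error 0 = 0.
Proof. rewrite cusa_error_reduced, sin_0, cos_0. field. Qed.

(** The numerator collapses to a multiple of a perfect cube; as [1 - cos x] is of
    order [x^2], the error is of order [x^7] at 0. *)
Lemma is_derive_cusa_error (x : R) :
  is_derive cusa_error x
    (2 * (1 - cos x) ^ 3 / (3 * (3 + 2 * cos x) ^ 2)).
Proof.
  pose proof (COS_bound x).
  apply is_derive_ext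
    with (fun x => x - sin x * (14 + cos x) / (3 * (3 + 2 * cos x))).
  { intros t. symmetry. apply cusa_error_reduced. }
  auto_derive; [lra|].
  transitivity
    (1 - ((14 * cos x + cos x ^ 2 - sin x ^ 2) * (9 + 6 * cos x)
          + 6 * sin x ^ 2 * (14 + cos x)) / (9 + 6 * cos x) ^ 2).
  - field. lra.
  - rewrite cos_sin_sqr. field. lra.
Qed.

Lemma cusa_error_lt (a b : R) : 0 <= a -> a < b -> b <= PI ->
  cusa_error a < cusa_error b.
Proof.
  intros ha hab hb.
  apply (is_derive_pos_lt cusa_error _ a b hab (fun c _ => is_derive_cusa_error c)).
  intros c hc. pose proof (cos_interior c ltac:(lra)).
  apply Rdiv_lt_0_compat.
  - apply Rmult_lt_0_compat; [lra|apply pow_lt; lra].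
  - apply Rmult_lt_0_compat; [lra|apply pow_lt; lra].
Qed.

Lemma cusa_error_pos (x : R) : 0 < x <= PI -> 0 < cusa_error x.
Proof.
  intros hx. rewrite <- cusa_error_0. apply cusa_error_lt; lra.
Qed.

(** * The critical equation has at most one root *)

Definition critical_num (c : R) : R := 294 + 217 * c + 14 * c ^ 2.

Definition critical_den (c : R) : R :=
  2 * c ^ 3 + 78 * c ^ 2 + 258 * c + 187.

Lemma critical_num_le (c d : R) : -1 <= c -> c <= d ->
  critical_num c <= critical_num d.
Proof. unfold critical_num. intros. nra. Qed.

Lemma critical_den_le (c d : R) : -1 <= c -> c <= d -> d <= 1 ->
  critical_den c <= critical_den d.
Proof.
  unfold critical_den. intros hc hcd hd.
  (* The product is critical_den d - critical_den c. *)
  assert (0 <= (d - c) * (2 * (d ^ 2 + d * c + c ^ 2) + 78 * (d + c) + 258)).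
  { apply Rmult_le_pos; nra. }
  nra.
Qed.

Lemma critical_den_pos (x : R) : 0 < critical_den (cos x).
Proof.
  pose proof (COS_bound x).
  pose proof (critical_den_le (-1) (cos x) ltac:(lra) ltac:(lra) ltac:(lra)) as h.
  unfold critical_den in *. lra.
Qed.

Definition critical_gap (x : R) : R :=
  sin x * critical_num (cos x) / critical_den (cos x) - x.

Lemma critical_eq_gap (t : R) : critical_eq t <-> critical_gap t = 0.
Proof.
  unfold critical_eq, critical_gap, critical_num, critical_den.
  replace (sin t * (294 + 217 * cos t + 14 * cos t ^ 2))
    with (294 * sin t + 217 * cos t * sin t + 14 * cos t ^ 2 * sin t) by ring.
  split; lra.
Qed.

Lemma is_derive_critical_gap (x : R) :
  is_derive critical_gap x
    ((1 - cos x) ^ 4 * (304 + 330 * cos x - 4 * cos x ^ 2)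
     / critical_den (cos x) ^ 2).
Proof.
  pose proof (critical_den_pos x) as hD.
  unfold critical_gap, critical_num, critical_den in *.
  auto_derive; [lra|].
  transitivity
    (((294 * cos x + 217 * (cos x ^ 2 - sin x ^ 2)
       + 14 * (cos x ^ 3 - 2 * cos x * sin x ^ 2))
        * (2 * cos x ^ 3 + 78 * cos x ^ 2 + 258 * cos x + 187)
      + sin x ^ 2 * (6 * cos x ^ 2 + 156 * cos x + 258)
        * (294 + 217 * cos x + 14 * cos x ^ 2))
     / (2 * cos x ^ 3 + 78 * cos x ^ 2 + 258 * cos x + 187) ^ 2 - 1).
  - field. lra.
  - rewrite cos_sin_sqr. field. lra.
Qed.

(** The quadratic factor of the derivative increases with the cosine, so the gap
    first grows from the value 0 and then falls.  At a point [s] where it is not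
    positive the growth is already over. *)
Lemma critical_gap_falls (s t : R) : 0 < s -> s < t -> t <= PI ->
  critical_gap s <= 0 -> critical_gap t < critical_gap s.
Proof.
  intros hs hst ht hgap.
  assert (hfac : forall y, 0 < y < PI ->
    0 < (1 - cos y) ^ 4 / critical_den (cos y) ^ 2).
  { intros y hy. pose proof (cos_interior y hy).
    apply Rdiv_lt_0_compat; apply pow_lt; [lra|apply critical_den_pos]. }
  assert (hneg : 304 + 330 * cos s - 4 * cos s ^ 2 < 0).
  { apply Rnot_le_lt. intros hnn. apply (Rle_not_lt _ _ hgap).
    replace 0 with (critical_gap 0)
      by (unfold critical_gap, Rdiv; rewrite sin_0; ring).
    apply (is_derive_pos_lt _ _ 0 s hs (fun c _ => is_derive_critical_gap c)).
    intros y hy.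
    pose proof (hfac y ltac:(lra)) as hy'.
    pose proof (cos_interior y ltac:(lra)).
    pose proof (cos_decreasing_1 y s ltac:(lra) ltac:(lra) ltac:(lra)
                  ltac:(lra) ltac:(lra)).
    assert (hq : 0 < 304 + 330 * cos y - 4 * cos y ^ 2) by nra.
    pose proof (Rmult_lt_0_compat _ _ hy' hq) as h.
    unfold Rdiv in *. lra. }
  apply (is_derive_neg_lt _ _ s t hst (fun c _ => is_derive_critical_gap c)).
  intros y hy.
  pose proof (hfac y ltac:(lra)) as hy'.
  pose proof (cos_interior s ltac:(lra)).
  pose proof (cos_interior y ltac:(lra)).
  pose proof (cos_decreasing_1 s y ltac:(lra) ltac:(lra) ltac:(lra)
                ltac:(lra) ltac:(lra)).
  assert (304 + 330 * cos y - 4 * cos y ^ 2 < 0) by nra.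
  pose proof (Rmult_lt_0_compat _ (- (304 + 330 * cos y - 4 * cos y ^ 2)) hy'
                ltac:(lra)) as h.
  unfold Rdiv in *. lra.
Qed.

Lemma critical_gap_pos_before (tau x : R) :
  critical_gap tau = 0 -> 0 < x < tau -> tau <= PI -> 0 < critical_gap x.
Proof.
  intros h0 hx ht. apply Rnot_le_lt. intros hle.
  pose proof (critical_gap_falls x tau ltac:(lra) ltac:(lra) ht hle). lra.
Qed.

Lemma critical_gap_neg_after (tau x : R) :
  critical_gap tau = 0 -> 0 < tau < x -> x <= PI -> critical_gap x < 0.
Proof.
  intros h0 hx ht.
  pose proof (critical_gap_falls tau x ltac:(lra) ltac:(lra) ht ltac:(lra)). lra.
Qed.

Lemma critical_gap_root_unique (s t : R) :
  0 < s < PI -> 0 < t < PI ->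
  critical_gap s = 0 -> critical_gap t = 0 -> s = t.
Proof.
  intros hs ht h0s h0t.
  destruct (Rtotal_order s t) as [h|[h|h]]; [|exact h|].
  - pose proof (critical_gap_neg_after s t h0s ltac:(lra) ltac:(lra)). lra.
  - pose proof (critical_gap_neg_after t s h0t ltac:(lra) ltac:(lra)). lra.
Qed.

(** * The root is the maximum of [g] *)

Definition g_slope_factor (x : R) : R :=
  critical_den (cos x) / (3 * (3 + 2 * cos x) ^ 2 * x ^ 8).

(** The derivative of [f / x^7] is [(x f' - 7 f) / x^8].  In [x f' - 7 f] the
    cube of [1 - cos x] and the square of [3 + 2 cos x] combine into
    [critical_den], which leaves the critical gap times a positive factor. *)
Lemma is_derive_g (x : R) : 0 < x ->
  is_derive g x (critical_gap x * g_slope_factor x).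
Proof.
  intros hx.
  pose proof (critical_den_pos x). pose proof (COS_bound x).
  assert (hp : is_derive (fun t : R => t ^ 7) x (7 * x ^ 6))
    by (auto_derive; [exact I|ring]).
  pose proof (is_derive_div cusa_error (fun t => t ^ 7) x _ _
                (is_derive_cusa_error x) hp
                (pow_nonzero x 7 ltac:(lra))) as h.
  refine (eq_rect _ (is_derive g x) h _ _).
  rewrite cusa_error_reduced.
  unfold g_slope_factor, critical_gap, critical_num, critical_den in *.
  (* The equation is over the carrier of a ring structure that [field] does not
     recognise as R. *)
  lazymatch goal with |- ?a = ?b => change (@eq R a b) end.
  field. lra.
Qed.

Lemma g_slope_factor_pos (x : R) : 0 < x -> 0 < g_slope_factor x.
Proof.
  intros hx. pose proof (COS_bound x).
  apply Rdiv_lt_0_compat; [apply critical_den_pos|].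
  apply Rmult_lt_0_compat; [|apply pow_lt; exact hx].
  apply Rmult_lt_0_compat; [lra|apply pow_lt; lra].
Qed.

Lemma g_le_at_root (tau x : R) :
  critical_gap tau = 0 -> 0 < tau < PI -> 0 < x <= PI -> g x <= g tau.
Proof.
  intros h0 ht hx.
  destruct (Rtotal_order x tau) as [h|[h|h]].
  - apply Rlt_le, (is_derive_pos_lt g
      (fun y => critical_gap y * g_slope_factor y) x tau h).
    + intros c hc. apply is_derive_g. lra.
    + intros c hc. apply Rmult_lt_0_compat.
      * apply (critical_gap_pos_before tau); lra.
      * apply g_slope_factor_pos. lra.
  - rewrite h. apply Rle_refl.
  - apply Rlt_le, (is_derive_neg_lt g
      (fun y => critical_gap y * g_slope_factor y) tau x h).
    + intros c hc. apply is_derive_g. lra.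
    + intros c hc.
      pose proof (critical_gap_neg_after tau c h0 ltac:(lra) ltac:(lra)).
      pose proof (Rmult_lt_0_compat _ (- critical_gap c)
                    (g_slope_factor_pos c ltac:(lra)) ltac:(lra)).
      lra.
Qed.

(** * Rational enclosures of the sine *)

(** The alternating series of sin y^(1/2) / y^(1/2) in nested form, entered at
    its [k]-th ratio of consecutive terms.  In this form a rational argument
    leaves no factorial to evaluate, only integers of moderate size. *)
Fixpoint sinc_horner (k : Z) (n : nat) (y : R) : R :=
  match n with
  | O => 1
  | S n' => 1 - y / IZR (2 * k * (2 * k + 1)) * sinc_horner (k + 1) n' y
  end.

(** The weight [fact (2 * j + 1)] normalises the first term of the tail to 1, so
    that removing that term leaves, up to one factor, the tail that starts at
    [j + 1]: this is what makes the induction go through. *)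
Lemma sinc_horner_sum (a : R) (n : nat) : forall j : nat,
  sum_f_R0 (fun i => (-1) ^ i * (a ^ (2 * i)
              * INR (fact (2 * j + 1)) / INR (fact (2 * (i + j) + 1)))) n
  = sinc_horner (Z.of_nat (S j)) n (a ^ 2).
Proof.
  induction n as [|n IH]; intros j.
  - simpl. field. apply INR_fact_neq_0.
  - rewrite decomp_sum by lia.
    cbn [sinc_horner pred].
    replace (Z.of_nat (S j) + 1)%Z with (Z.of_nat (S (S j))) by lia.
    rewrite <- (IH (S j)).
    unfold Rminus. apply f_equal2.
    { simpl. field. apply INR_fact_neq_0. }
    rewrite Ropp_mult_distr_l, scal_sum.
    apply sum_eq. intros i _.
    replace (2 * (S i + j) + 1)%nat with (2 * (i + S j) + 1)%nat by lia.
    replace (2 * S j + 1)%nat with (S (S (2 * j + 1))) by lia.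
    rewrite (fact_simpl (S (2 * j + 1))), (fact_simpl (2 * j + 1)), !mult_INR.
    replace (2 * Z.of_nat (S j) * (2 * Z.of_nat (S j) + 1))%Z
      with (Z.of_nat (S (2 * j + 1)) * Z.of_nat (S (S (2 * j + 1))))%Z by lia.
    rewrite mult_IZR, <- !INR_IZR_INZ.
    replace (2 * S i)%nat with (2 * i + 2)%nat by lia.
    rewrite pow_add. cbn [pow].
    field.
    repeat split; try apply INR_fact_neq_0; apply not_0_INR; lia.
Qed.

Lemma sin_approx_horner (a : R) (n : nat) :
  sin_approx a n = a * sinc_horner 1 n (a ^ 2).
Proof.
  change 1%Z with (Z.of_nat 1). rewrite <- (sinc_horner_sum a n 0).
  unfold sin_approx. rewrite scal_sum. apply sum_eq. intros i _.
  unfold sin_term. rewrite Nat.add_0_r, pow_add. cbn [fact Nat.mul Nat.add].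
  simpl (INR 1). field. apply INR_fact_neq_0.
Qed.

Lemma sin_horner_bounds (a : R) (n : nat) : 0 <= a <= 4 ->
  a * sinc_horner 1 (2 * n + 1) (a ^ 2) <= sin a
  <= a * sinc_horner 1 (2 * (n + 1)) (a ^ 2).
Proof.
  intros [h0 h4]. rewrite <- !sin_approx_horner.
  exact (pre_sin_bound a n h0 h4).
Qed.

(** Only the integer arithmetic of the coefficients is computed: [IZR] and the
    operations on reals must stay in place for [lra] to read them. *)
Ltac unfold_horner H :=
  cbn [sinc_horner Z.add Z.mul Pos.add Pos.add_carry Pos.mul Pos.succ
       Nat.mul Nat.add] in H.

Lemma PI_lt_16_5 : PI < 16 / 5.
Proof.
  (* The Taylor upper bound of sin (16 / 5) is negative. *)
  destruct (Rlt_or_le PI (16 / 5)) as [h|h]; [exact h|exfalso].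
  destruct (sin_horner_bounds (16 / 5) 3) as [_ hu]; [lra|].
  assert (0 <= sin (16 / 5)) by (apply sin_ge_0; lra).
  unfold_horner hu. lra.
Qed.

Lemma cos_half_sin_sqr (x : R) : cos x = 1 - 2 * sin (x / 2) ^ 2.
Proof.
  replace x with (2 * (x / 2)) at 1 by field.
  rewrite cos_2a_sin. ring.
Qed.

(** * The lower bound *)

(** With [s = sin u / u] and [v = u^2] the claim is
    [5 s^3 + 4 v s^2 > 5], whose left side increases with [s]; the bound
    [s >= 1 - v/6 + v^2/128], valid up to [v = 2.56], leaves a polynomial
    inequality in [v]. *)
Lemma five_sin_cube_gt (u : R) : 0 < u <= 8 / 5 ->
  u ^ 3 * (5 - 4 * sin u ^ 2) < 5 * sin u ^ 3.
Proof.
  intros hu.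
  destruct (sin_horner_bounds u 1) as [hl _]; [lra|].
  unfold_horner hl.
  assert (hv : 0 < u ^ 2 <= 64 / 25) by nra.
  set (v := u ^ 2) in *.
  set (q := 1 - v / 6 + v ^ 2 / 128).
  assert (hq : 0 < q) by (unfold q; nra).
  assert (hs : u * q <= sin u).
  { refine (Rle_trans _ _ _ _ hl). apply Rmult_le_compat_l; [lra|].
    unfold q. nra. }
  assert (hpoly : 0 < 5 * q ^ 3 + 4 * v * q ^ 2 - 5).
  { (* The polynomial is v times a quintic.  The constant 95/1000 splits the
         quadratic coefficient of the quintic: one part keeps the quadratic
         positive, the other one outweighs the negative cubic term. *)
    assert (hquad : 0 < 3 / 2 - 307 / 384 * v + 95 / 1000 * v ^ 2) by nra.
    assert (hrest : 0 <= v ^ 2 * (385 / 3456 - 95 / 1000 - 307 / 49152 * v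
                                  + 3 / 32768 * v ^ 2 + 5 / 2097152 * v ^ 3)).
    { apply Rmult_le_pos; [apply pow_le; lra|].
      pose proof (pow_le v 2 ltac:(lra)). pose proof (pow_le v 3 ltac:(lra)). lra. }
    pose proof (Rmult_lt_0_compat _ _ (proj1 hv) (Rplus_lt_le_0_compat _ _ hquad hrest)).
    unfold q. lra. }
  assert (h0 : 0 < u * q) by (apply Rmult_lt_0_compat; lra).
  pose proof (pow_incr _ _ 3 (conj (Rlt_le _ _ h0) hs)) as h3.
  pose proof (pow_incr _ _ 2 (conj (Rlt_le _ _ h0) hs)) as h2.
  assert (hu3 : 0 < u ^ 3) by (apply pow_lt; lra).
  pose proof (Rmult_lt_0_compat _ _ hu3 hpoly) as hp.
  pose proof (Rmult_le_compat_l _ _ _ (Rlt_le _ _ hu3) h2) as h2'.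
  unfold v in hp. lra.
Qed.

Lemma cusa_error_slope_gt (x : R) : 0 < x < PI ->
  x ^ 6 / 300 < 2 * (1 - cos x) ^ 3 / (3 * (3 + 2 * cos x) ^ 2).
Proof.
  intros hx. pose proof PI_lt_16_5.
  pose proof (five_sin_cube_gt (x / 2) ltac:(lra)) as h.
  rewrite cos_half_sin_sqr.
  assert (hd : 0 < 5 - 4 * sin (x / 2) ^ 2).
  { pose proof (cos_half_sin_sqr x). pose proof (COS_bound x). lra. }
  set (s := sin (x / 2)) in *.
  assert (hpos : 0 <= (x / 2) ^ 3 * (5 - 4 * s ^ 2)).
  { apply Rmult_le_pos; [apply pow_le|]; lra. }
  (* Squaring turns the cubes into the sixth powers of the claim. *)
  assert (hsq : ((x / 2) ^ 3 * (5 - 4 * s ^ 2)) ^ 2 < (5 * s ^ 3) ^ 2) by nra.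
  replace (3 + 2 * (1 - 2 * s ^ 2)) with (5 - 4 * s ^ 2) by ring.
  assert (hd2 : 0 < (5 - 4 * s ^ 2) ^ 2) by (apply pow_lt; exact hd).
  apply Rmult_lt_reg_r with (3 * (5 - 4 * s ^ 2) ^ 2); [lra|].
  replace (2 * (1 - (1 - 2 * s ^ 2)) ^ 3 / (3 * (5 - 4 * s ^ 2) ^ 2)
           * (3 * (5 - 4 * s ^ 2) ^ 2)) with (16 * s ^ 6) by (field; lra).
  lra.
Qed.

Lemma cusa_error_gt (x : R) : 0 < x <= PI -> 1 / 2100 * x ^ 7 < cusa_error x.
Proof.
  intros hx.
  apply Rminus_lt_0.
  replace 0 with (cusa_error 0 - 1 / 2100 * 0 ^ 7)
    by (rewrite cusa_error_0; ring).
  apply (is_derive_pos_lt (fun t => cusa_error t - 1 / 2100 * t ^ 7)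
           (fun t => 2 * (1 - cos t) ^ 3 / (3 * (3 + 2 * cos t) ^ 2) - t ^ 6 / 300)
           0 x ltac:(lra)).
  - intros c _. apply (is_derive_minus cusa_error (fun t => 1 / 2100 * t ^ 7)).
    + apply is_derive_cusa_error.
    + auto_derive; [exact I|field].
  - intros c hc. pose proof (cusa_error_slope_gt c ltac:(lra)). lra.
Qed.

(** * Locating the root and its value *)

(** The width 7e-11 comes from the upper end of the decimal enclosure of [1 / g]:
    the true value 899.0406296943... lies only 3e-7 below 899.04063, and
    [root_hi ^ 7 / cusa_error root_lo] exceeds it by less than 2e-7. *)
Definition root_lo : R := 2.87934579545.
Definition root_hi : R := 2.87934579552.

Lemma root_hi_lt_PI : root_hi < PI.
Proof. pose proof PI2_3_2. unfold root_hi. lra. Qed.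

Lemma sin_root_lo : 0.25925124233499 <= sin root_lo <= 0.25925124233500.
Proof.
  destruct (sin_horner_bounds root_lo 6) as [hl hu]; [unfold root_lo; lra|].
  unfold_horner hl. unfold_horner hu. unfold root_lo in *. lra.
Qed.

Lemma sin_root_hi : 0.25925124226738 <= sin root_hi <= 0.25925124226739.
Proof.
  destruct (sin_horner_bounds root_hi 6) as [hl hu]; [unfold root_hi; lra|].
  unfold_horner hl. unfold_horner hu. unfold root_hi in *. lra.
Qed.

Lemma cos_root_lo : -0.96580991574320 <= cos root_lo <= -0.96580991574310.
Proof.
  rewrite cos_half_sin_sqr.
  destruct (sin_horner_bounds (root_lo / 2) 6) as [hl hu]; [unfold root_lo; lra|].
  assert (0.99141563325961 <= sin (root_lo / 2) <= 0.99141563325963)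
    by (unfold_horner hl; unfold_horner hu; unfold root_lo in *; lra).
  nra.
Qed.

Lemma cos_root_hi : -0.96580991576140 <= cos root_hi <= -0.96580991576115.
Proof.
  rewrite cos_half_sin_sqr.
  destruct (sin_horner_bounds (root_hi / 2) 6) as [hl hu]; [unfold root_hi; lra|].
  assert (0.99141563326418 <= sin (root_hi / 2) <= 0.99141563326420)
    by (unfold_horner hl; unfold_horner hu; unfold root_hi in *; lra).
  nra.
Qed.

Lemma critical_gap_root_lo : 0 < critical_gap root_lo.
Proof.
  pose proof sin_root_lo as hs. pose proof cos_root_lo as hc.
  pose proof (critical_den_pos root_lo) as hD.
  unfold critical_gap.
  apply -> Rminus_lt_0. apply (proj1 (Rlt_div_r root_lo (sin root_lo * _) _ hD)).
  pose proof (critical_den_le (cos root_lo) (-0.96580991574310)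
                ltac:(lra) (proj2 hc) ltac:(lra)) as hden.
  pose proof (critical_num_le (-0.96580991574320) (cos root_lo)
                ltac:(lra) (proj1 hc)) as hnum.
  assert (hn0 : 0 <= critical_num (-0.96580991574320))
    by (unfold critical_num; lra).
  pose proof (Rmult_le_compat 0.25925124233499 _ _ _ ltac:(lra) hn0
                (proj1 hs) hnum) as hm.
  apply (Rmult_le_compat_l root_lo) in hden; [|unfold root_lo; lra].
  refine (Rle_lt_trans _ _ _ hden (Rlt_le_trans _ _ _ _ hm)).
  unfold root_lo, critical_num, critical_den. lra.
Qed.

Lemma critical_gap_root_hi : critical_gap root_hi < 0.
Proof.
  pose proof sin_root_hi as hs. pose proof cos_root_hi as hc.
  pose proof (critical_den_pos root_hi) as hD.
  unfold critical_gap.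
  apply Rlt_minus, (proj2 (Rlt_div_l (sin root_hi * _) root_hi _ hD)).
  pose proof (critical_den_le (-0.96580991576140) (cos root_hi)
                ltac:(lra) (proj1 hc) ltac:(lra)) as hden.
  pose proof (critical_num_le (cos root_hi) _ ltac:(lra) (proj2 hc)) as hnum.
  pose proof (critical_num_le (-1) (cos root_hi) ltac:(lra) ltac:(lra)) as hn0.
  unfold critical_num at 1 in hn0.
  pose proof (Rmult_le_compat (sin root_hi) _ (critical_num (cos root_hi)) _
                ltac:(lra) ltac:(lra) (proj2 hs) hnum) as hm.
  apply (Rmult_le_compat_l root_hi) in hden; [|unfold root_hi; lra].
  refine (Rle_lt_trans _ _ _ hm (Rlt_le_trans _ _ _ _ hden)).
  unfold root_hi, critical_num, critical_den. lra.
Qed.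

Lemma cusa_error_root_lo : 1.82506129015 < cusa_error root_lo.
Proof.
  pose proof sin_root_lo as hs. pose proof cos_root_lo as hc.
  rewrite cusa_error_reduced.
  assert (sin root_lo * (14 + cos root_lo) / (3 * (3 + 2 * cos root_lo))
          < root_lo - 1.82506129015); [|lra].
  apply Rlt_div_l; [lra|].
  pose proof (Rmult_le_compat (sin root_lo) _ (14 + cos root_lo) (14 - 0.96580991574310)
                ltac:(lra) ltac:(lra) (proj2 hs) ltac:(lra)).
  unfold root_lo in *. lra.
Qed.

Lemma cusa_error_root_hi : cusa_error root_hi < 1.82506129055.
Proof.
  pose proof sin_root_hi as hs. pose proof cos_root_hi as hc.
  rewrite cusa_error_reduced.
  assert (root_hi - 1.82506129055
          < sin root_hi * (14 + cos root_hi) / (3 * (3 + 2 * cos root_hi))); [|lra].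
  apply Rlt_div_r; [lra|].
  pose proof (Rmult_le_compat 0.25925124226738 _ (14 - 0.96580991576140)
                (14 + cos root_hi)
                ltac:(lra) ltac:(lra) (proj1 hs) ltac:(lra)).
  unfold root_hi in *. lra.
Qed.

Lemma critical_gap_root_exists :
  exists tau, root_lo <= tau <= root_hi /\ critical_gap tau = 0.
Proof.
  destruct (IVT_cor critical_gap root_lo root_hi) as [tau h].
  - intros x. apply derivable_continuous_pt.
    eexists. apply is_derive_Reals, is_derive_critical_gap.
  - unfold root_lo, root_hi. lra.
  - pose proof critical_gap_root_lo. pose proof critical_gap_root_hi. nra.
  - exists tau. exact h.
Qed.

(** Both [x^7] and [cusa_error x] increase, so each part of the quotient
    [1 / g = x^7 / cusa_error x] is enclosed by its values at the end points. *)
Lemma inv_g_enclosure (tau : R) : root_lo <= tau <= root_hi ->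
  899.04062 <= 1 / g tau < 899.04063.
Proof.
  intros ht. pose proof root_hi_lt_PI.
  assert (hlo : cusa_error root_lo <= cusa_error tau).
  { destruct (proj1 ht) as [h|h]; [|rewrite h; lra].
    apply Rlt_le, cusa_error_lt; unfold root_lo in *; lra. }
  assert (hhi : cusa_error tau <= cusa_error root_hi).
  { destruct (proj2 ht) as [h|h]; [|rewrite h; lra].
    apply Rlt_le, cusa_error_lt; unfold root_lo in *; lra. }
  pose proof cusa_error_root_lo. pose proof cusa_error_root_hi.
  assert (h0 : 0 < tau) by (unfold root_lo in *; lra).
  pose proof (pow_incr root_lo tau 7 ltac:(unfold root_lo in *; lra)) as hp1.
  pose proof (pow_incr tau root_hi 7 ltac:(lra)) as hp2.
  replace (1 / g tau) with (tau ^ 7 / cusa_error tau)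
    by (unfold g; field; split; [apply Rgt_not_eq|]; lra).
  split.
  - apply (proj1 (Rle_div_r 899.04062 (tau ^ 7) (cusa_error tau) ltac:(lra))).
    unfold root_lo in hp1. lra.
  - apply (proj2 (Rlt_div_l (tau ^ 7) 899.04063 (cusa_error tau) ltac:(lra))).
    unfold root_hi in hp2. lra.
Qed.

Theorem theorem5 :
  exists tau0 m2 : R,
    unique (fun t : R => 0 < t < PI /\ critical_eq t) tau0 /\
    2.87934 <= tau0 < 2.87935 /\
    m2 = 1 / g tau0 /\
    899.04062 <= m2 < 899.04063 /\
    forall x : R, 0 < x <= PI ->
      1 / 2100 * x ^ 7
        < x - 3 * sin x / (2 + cos x)
              * (1 + (1 - cos x) ^ 2 / (9 * (3 + 2 * cos x)))
        <= 1 / m2 * x ^ 7.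
Proof.
  destruct critical_gap_root_exists as [tau [ht h0]].
  pose proof root_hi_lt_PI.
  assert (hloc : 0 < tau < PI) by (unfold root_lo in *; lra).
  exists tau, (1 / g tau). split; [split|split; [|split; [|split]]].
  - split; [exact hloc|apply critical_eq_gap, h0].
  - intros t [ht1 ht2]. apply critical_gap_root_unique; try assumption.
    apply critical_eq_gap, ht2.
  - unfold root_lo, root_hi in *. lra.
  - reflexivity.
  - apply inv_g_enclosure, ht.
  - intros x hx. fold (cusa_error x). split; [apply cusa_error_gt, hx|].
    assert (hg0 : 0 < g tau).
    { apply Rdiv_lt_0_compat; [apply cusa_error_pos|apply pow_lt]; lra. }
    replace (1 / (1 / g tau)) with (g tau) by (field; lra).
    assert (hx7 : x ^ 7 > 0) by (apply pow_lt; lra).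
    apply (proj1 (Rle_div_l (cusa_error x) (g tau) (x ^ 7) hx7)).
    apply (g_le_at_root tau x h0 hloc hx).
Qed.
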